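(* Let $k$ and $j$ be non-negative integers, let $p'=5+24j$ and $q'=9+30k+144jk+24j$, let $K=K_{p'/q'}$, and let $\alpha_k=\frac{1-t^{6k}}{1-t^6}$. Then the $3$-twisted Alexander polynomial of $K$ is $$\tilde\Delta^3_{p'/q'}(t)\doteq\frac{\Delta_K(t)}{t-1}\,t^4(t-1)(t+1)\left(t^6\alpha_k-t^3\alpha_k+1\right)\left(t^6\alpha_k+t^3\alpha_k+1\right),$$ where $\doteq$ denotes equality up to a factor $\pm t^{3r}$, $r\in\mathbb Z$. Moreover, $K$ satisfies the Hirasawa–Murasugi conjecture (in its strong form) for $\ell=3$ with $f(t)=t^2(1+t)(1-t^3\alpha_k+t^6\alpha_k)$; that is, for suitable representatives $\tilde\Delta(t)$ of the $3$-twisted Alexander polynomial (defined up to $\pm t^{3r}$) and $\Delta(t)$ of the Alexander polynomial of $K$ (defined up to $\pm t^r$), one has $$\tilde\Delta(t)=\frac{\Delta(t)}{t-1}f(t)f(-t)\qquad\text{and}\qquad f(t)\equiv\frac{\Delta(t)}{t+1}\pmod 3 .$$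
   Context: For odd coprime integers $0<p<q$, $K_{p/q}$ is the corresponding 2-bridge knot and $\epsilon_i=(-1)^{\lfloor ip/q\rfloor}$. The canonical form of the Alexander polynomial is $\Delta_{K_{p/q}}(t)=1-t^{\epsilon_1}+t^{\epsilon_1+\epsilon_2}-\dots+t^{\epsilon_1+\dots+\epsilon_{q-1}}$. The congruence mod $3$ means $(t+1)f(t)\equiv\Delta(t)$ coefficientwise mod $3$. For an odd prime $\ell\mid q$ the $\ell$-twisted Alexander polynomial is defined as follows. The knot group is $G_{p/q}=\langle a,b\mid aw=wb\rangle$ with $w=b^{\epsilon_1}a^{\epsilon_2}b^{\epsilon_3}\cdots a^{\epsilon_{q-1}}$. The dihedral group is $D_\ell=\langle x,y\mid x^2=1,\ y^\ell=1,\ yx=xy^{-1}\rangle$. Fix $\pi:D_\ell\to GL(\ell,\mathbb C)$ with $\pi(x)=F$, the matrix with ones on the antidiagonal and zeros elsewhere, and $\pi(y)=R$, the matrix with ones in positions $(1,\ell)$ and $(i+1,i)$, $1\le i<\ell$, and zeros elsewhere. Let $\rho:G_{p/q}\to D_\ell$ be any surjective homomorphism and $\phi=\pi\circ\rho$. With $\partial w/\partial a$ the Fox derivative, let $$\hat A_\phi=I+(t\phi(a)-I)\left.\frac{\partial w}{\partial a}\right|_{a=t\phi(a),\,b=t\phi(b)}$$ (the group ring element $1$ is replaced by the identity matrix). Then $\tilde\Delta^\ell_{p/q}(t)=\det\hat A_\phi/\det(t\phi(b)-I)$, considered up to factors $\pm t^{r\ell}$; up to such factors it does not depend on $\rho$.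 *)

(* Defs.v *)
From HB Require Import structures.
From mathcomp Require Import all_boot all_order all_algebra.
From mathcomp Require Import boolp reals complex.

Set Implicit Arguments.
Unset Strict Implicit.
Unset Printing Implicit Defensive.

Import GRing.Theory.
Local Open Scope ring_scope.
Local Open Scope quotient_scope.

Section Presentation.
Variable X : choiceType.

(* (x, false) stands for x and (x, true) for x^-1. *)
Definition letter := (X * bool)%type.
Definition letter_inv (l : letter) : letter := (l.1, ~~ l.2).
Definition word := seq letter.
Definition word_inv (u : word) : word := rev (map letter_inv u).

Variable rels : seq (word * word).

Inductive word_eq : word -> word -> Prop :=
| word_eq_refl u : word_eq u u
| word_eq_sym u v : word_eq u v -> word_eq v u
| word_eq_trans u v w : word_eq u v -> word_eq v w -> word_eq u w
| word_eq_cat u u' v v' :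
    word_eq u u' -> word_eq v v' -> word_eq (u ++ v) (u' ++ v')
| word_eq_inv l : word_eq [:: l; letter_inv l] [::]
| word_eq_rel u v : (u, v) \in rels -> word_eq u v.

Definition word_eqb (u v : word) : bool := `[< word_eq u v >].

Lemma word_eqb_refl : reflexive word_eqb.
Proof. by move=> u; apply/asboolP; apply: word_eq_refl. Qed.

Lemma word_eqb_sym : symmetric word_eqb.
Proof. by move=> u v; apply: asbool_equiv_eq; split; apply: word_eq_sym. Qed.

Lemma word_eqb_trans : transitive word_eqb.
Proof.
move=> v u w /asboolP uv /asboolP vw; apply/asboolP.
exact: word_eq_trans uv vw.
Qed.

Canonical word_equiv := EquivRel word_eqb word_eqb_refl word_eqb_sym word_eqb_trans.

(* < X | u = v for (u, v) in rels >, as words modulo the least congruence. *)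
Definition presented := {eq_quot word_equiv}.
HB.instance Definition _ := Choice.on presented.
HB.instance Definition _ := EqQuotient.on presented.

Lemma presentedP u v : reflect (word_eq u v) (\pi_presented u == \pi_presented v).
Proof. by rewrite eqquotE; apply: asboolP. Qed.

Lemma word_eq_repr u : word_eq (repr (\pi_presented u)) u.
Proof. by apply/presentedP; rewrite reprK. Qed.

Lemma letter_invK : involutive letter_inv.
Proof. by case=> x b; rewrite /letter_inv /= negbK. Qed.

Lemma word_inv_cons l u : word_inv (l :: u) = word_inv u ++ [:: letter_inv l].
Proof. by rewrite /word_inv /= rev_cons cats1. Qed.

Lemma word_invK : involutive word_inv.
Proof.
by move=> u; rewrite /word_inv map_rev revK -map_comp map_id_in // => l _ /=;
  rewrite letter_invK.
Qed.

Lemma word_eq_invr u : word_eq (u ++ word_inv u) [::].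
Proof.
elim: u => [|l u IHu]; first exact: word_eq_refl.
rewrite word_inv_cons.
have -> : (l :: u) ++ word_inv u ++ [:: letter_inv l] =
  [:: l] ++ ((u ++ word_inv u) ++ [:: letter_inv l]) by rewrite -!catA.
apply: word_eq_trans (word_eq_inv l).
apply: (@word_eq_cat [:: l] [:: l] _ [:: letter_inv l]); first exact: word_eq_refl.
exact: (word_eq_cat IHu (word_eq_refl [:: letter_inv l])).
Qed.

Lemma word_eq_invl u : word_eq (word_inv u ++ u) [::].
Proof. by rewrite -{2}[u]word_invK; apply: word_eq_invr. Qed.

Lemma word_eq_inv_congr u v : word_eq u v -> word_eq (word_inv u) (word_inv v).
Proof.
move=> uv; rewrite -[word_inv u]cats0 -[word_inv v]cat0s.
apply: (word_eq_trans
  (word_eq_cat (word_eq_refl (word_inv u)) (word_eq_sym (word_eq_invr v)))).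
rewrite catA; apply: word_eq_cat (word_eq_refl _).
apply: (word_eq_trans
  (word_eq_cat (word_eq_refl (word_inv u)) (word_eq_sym uv))).
exact: word_eq_invl.
Qed.

Definition pres_of (u : word) : presented := \pi u.
Definition pres_one : presented := pres_of [::].
Definition pres_mul (g h : presented) : presented := pres_of (repr g ++ repr h).
Definition pres_inv (g : presented) : presented := pres_of (word_inv (repr g)).

Lemma pres_ofW (P : presented -> Prop) : (forall u, P (pres_of u)) -> forall g, P g.
Proof. by move=> Pu; elim/quotW. Qed.

Lemma pres_of_cat u v : pres_of (u ++ v) = pres_mul (pres_of u) (pres_of v).
Proof.
apply/eqP/presentedP; apply: word_eq_sym.
by apply: word_eq_cat; apply: word_eq_repr.
Qed.

Lemma pres_of_inv u : pres_of (word_inv u) = pres_inv (pres_of u).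
Proof.
by apply/eqP/presentedP/word_eq_inv_congr/word_eq_sym/word_eq_repr.
Qed.

Lemma pres_mulA : associative pres_mul.
Proof.
elim/pres_ofW => u; elim/pres_ofW => v; elim/pres_ofW => w.
by rewrite -!pres_of_cat catA.
Qed.

Lemma pres_mul1g : left_id pres_one pres_mul.
Proof. by elim/pres_ofW => u; rewrite -pres_of_cat. Qed.

Lemma pres_mulg1 : right_id pres_one pres_mul.
Proof. by elim/pres_ofW => u; rewrite -pres_of_cat cats0. Qed.

Lemma pres_mulVg : left_inverse pres_one pres_inv pres_mul.
Proof.
elim/pres_ofW => u; rewrite -pres_of_inv -pres_of_cat.
by apply/eqP/presentedP/word_eq_invl.
Qed.

Lemma pres_mulgV : right_inverse pres_one pres_inv pres_mul.
Proof.
elim/pres_ofW => u; rewrite -pres_of_inv -pres_of_cat.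
by apply/eqP/presentedP/word_eq_invr.
Qed.

HB.instance Definition _ := isGroup.Build presented
  pres_mulA pres_mul1g pres_mulg1 pres_mulVg pres_mulgV.

Definition pres_gen (x : X) : presented := pres_of [:: (x, false)].

(* The Fox derivative d u / d x, as a formal Z-linear combination of words:
   d(1) = 0, d(x u) = 1 + x d(u), d(x^-1 u) = - x^-1 + x^-1 d(u), and
   d(y u) = y d(u) for every letter y other than x and x^-1. *)
Fixpoint fox_deriv (x : X) (u : word) : seq (int * word) :=
  if u is l :: u' then
    (if l.1 != x then [::]
     else if l.2 then [:: (-1, [:: l])] else [:: (1, [::])])
    ++ [seq (c.1, l :: c.2) | c <- fox_deriv x u']
  else [::].

Section Evaluation.
Variables (F : fieldType) (n : nat) (M : X -> 'M[F]_n).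

Definition word_mx (u : word) : 'M[F]_n :=
  foldr (fun l A => (if l.2 then invmx (M l.1) else M l.1) *m A) 1%:M u.

Definition comb_mx (s : seq (int * word)) : 'M[F]_n :=
  \sum_(c <- s) c.1%:~R *: word_mx c.2.

End Evaluation.
End Presentation.

Arguments pres_gen {X rels} x.

(* Both groups below have two generators, indexed by bool:
   false is a (resp. x) and true is b (resp. y). *)
Definition gen_a : bool := false.
Definition gen_b : bool := true.
Definition gen_x : bool := false.
Definition gen_y : bool := true.

Definition eps (p q i : nat) : int := (-1) ^+ (i * p %/ q).

(* b^(eps 1) a^(eps 2) b^(eps 3) ... a^(eps (q - 1)) *)
Definition knot_word (p q : nat) : word bool :=
  [seq (if odd i then gen_b else gen_a, eps p q i == -1) | i <- iota 1 q.-1].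

Definition knot_group (p q : nat) : groupType :=
  presented [:: ((gen_a, false) :: knot_word p q,
                 knot_word p q ++ [:: (gen_b, false)])].

Definition dihedral_group (ell : nat) : groupType :=
  presented [:: ([:: (gen_x, false); (gen_x, false)], [::]);
                (nseq ell (gen_y, false), [::]);
                ([:: (gen_y, false); (gen_x, false)],
                 [:: (gen_x, false); (gen_y, true)])].

Definition flip_mx (C : fieldType) (n : nat) : 'M[C]_n :=
  \matrix_(i < n, j < n) ((i + j)%N == n.-1)%:R.

Definition rot_mx (C : fieldType) (n : nat) : 'M[C]_n :=
  \matrix_(i < n, j < n)
    ((i == j.+1 :> nat) || (i == 0%N :> nat) && (j == n.-1 :> nat))%:R.

Definition is_dihedral_rep (C : fieldType) (ell : nat)
    (pi : dihedral_group ell -> 'M[C]_ell) : Prop :=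
  [/\ pi 1%g = 1%:M, {morph pi : g h / (g * h)%g >-> g *m h},
      pi (pres_gen gen_x) = flip_mx C ell &
      pi (pres_gen gen_y) = rot_mx C ell].

(* Laurent polynomials in t over C (or over int) live in the field C(t). *)
Notation ratfun C := {fraction {poly C}}.

Definition tvar (C : fieldType) : ratfun C := FracField.tofrac 'X.

Definition constf (C : fieldType) (c : C) : ratfun C := FracField.tofrac c%:P.

Definition intpoly (C : fieldType) (P : {poly int}) : ratfun C :=
  FracField.tofrac (map_poly intr P).

(* In characteristic 0, P and Q are determined by x, y and n, and the condition
   does not depend on n: this is coefficientwise congruence in Z[t, t^-1]. *)
Definition laurent_cong (C : fieldType) (m : nat) (x y : ratfun C) : Prop :=
  exists (n : nat) (P Q : {poly int}),
    [/\ x = intpoly C P / tvar C ^+ n, y = intpoly C Q / tvar C ^+ n &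
        forall i, (P`_i = Q`_i %[mod m%:Z])%Z].

(* Equality up to a factor +- t^(n r). *)
Definition doteq (C : fieldType) (n : nat) (x y : ratfun C) : Prop :=
  exists (s : bool) (r : int), x = (-1) ^+ s * tvar C ^ (n%:Z * r) * y.

Definition alexander_poly (C : fieldType) (p q : nat) : ratfun C :=
  \sum_(m < q) (-1) ^+ m * tvar C ^ (\sum_(1 <= i < m.+1) eps p q i).

Section TwistedAlexander.
Variables (C : fieldType) (ell p q : nat) (phi : knot_group p q -> 'M[C]_ell).

Definition tphi (g : bool) : 'M[ratfun C]_ell :=
  tvar C *: map_mx (@constf C) (phi (pres_gen g)).

Definition A_hat : 'M[ratfun C]_ell :=
  1%:M + (tphi gen_a - 1%:M) *m comb_mx tphi (fox_deriv gen_a (knot_word p q)).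

Definition twisted_alexander : ratfun C :=
  \det A_hat / \det (tphi gen_b - 1%:M).

End TwistedAlexander.

(* The strong form of the Hirasawa-Murasugi conjecture for ell = 3, given one
   representative Dtw of the twisted polynomial, one representative D of the
   Alexander polynomial, and the integer polynomial f. *)
Definition Hirasawa_Murasugi3 (C : fieldType) (Dtw D : ratfun C)
    (f : {poly int}) : Prop :=
  exists Dtw' D' : ratfun C,
    [/\ doteq 3 Dtw' Dtw, doteq 1 D' D,
        Dtw' = D' / (tvar C - 1) * intpoly C f * intpoly C (f \Po - 'X) &
        laurent_cong 3 ((tvar C + 1) * intpoly C f) D'].

(* Main.v *)
Require Import Defs.
From mathcomp Require Import all_boot all_order all_algebra.
From mathcomp Require Import boolp reals complex.
From HB Require Import structures.
From mathcomp Require Import perm ring zify.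
Import GRing.Theory.
Local Open Scope ring_scope.

(** Write [q = p L + 4] with [L = 6 k + 1].  The signs [eps i] then come in [p]
blocks of length [L], three of them lengthened by one, and with [A = (ab)^{3k} a],
[B = (ba)^{3k} b], [U = (a^-1 b^-1)^{3k+1}], [V = (ab)^{3k+1}] the knot word is
[(B A^-1)^{3j} B U (A B^-1)^{3j} V (A^-1 B)^{3j} U (A B^-1)^{3j} A].

A surjection onto the dihedral group sends [a] and [b] to two distinct reflections,
so the representation splits as trivial plus two-dimensional.  The trivial summand
contributes [Delta / (t - 1)].  In the two-dimensional one [A B^-1] and its variants
are rotations of order 3, whose [3 j] successive powers add up to 0; hence [j]
disappears and the determinant is a rational function of [t] and [t^{6k}].  The same
blocks give [Delta] in closed form, with [j] occurring only in multiples of [6 j];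
modulo 3 it is [(1 + t^{6k+3}) / (1 + t)] up to a power of [t], which is compared with
[f] through [(1 + t)^3 = 1 + t^3]. *)

(** * Evaluation of words and Fox derivatives in a unit ring *)

Section FoxEvaluation.
Context {X : choiceType}.

(** Values lie in an arbitrary unit ring so that the same product rules serve the scalars [t], the 1
    by 1 matrices [t%:M] and the 2 by 2 matrices [quot_rep t]. *)
Definition letter_val {S : unitRingType} (N : X -> S) (l : letter X) : S :=
  if l.2 then (N l.1)^-1 else N l.1.

Definition word_val {S : unitRingType} (N : X -> S) (u : word X) : S :=
  \prod_(l <- u) letter_val N l.

Definition comb_val {S : unitRingType} (N : X -> S) (s : seq (int * word X)) : S :=
  \sum_(c <- s) c.1%:~R * word_val N c.2.

Definition fox_val {S : unitRingType} (N : X -> S) (x : X) (u : word X) : S :=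
  comb_val N (fox_deriv x u).

Section UnitRing.
Variables (S : unitRingType) (N : X -> S).

Lemma word_val_nil : word_val N [::] = 1.
Proof. by rewrite /word_val big_nil. Qed.

Lemma word_val_cons l u : word_val N (l :: u) = letter_val N l * word_val N u.
Proof. by rewrite /word_val big_cons. Qed.

Lemma word_val_cat u v : word_val N (u ++ v) = word_val N u * word_val N v.
Proof. by rewrite /word_val big_cat. Qed.

Lemma word_val_pow n u : word_val N (flatten (nseq n u)) = word_val N u ^+ n.
Proof.
elim: n => [|n IHn] /=; first by rewrite word_val_nil.
by rewrite word_val_cat IHn exprS.
Qed.

Lemma fox_val_nil x : fox_val N x [::] = 0.
Proof. by rewrite /fox_val /comb_val big_nil. Qed.

Lemma fox_val_cons x l u :
  fox_val N x (l :: u) =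
    (if l.1 != x then 0 else if l.2 then - letter_val N l else 1)
    + letter_val N l * fox_val N x u.
Proof.
rewrite /fox_val /comb_val /= big_cat big_map /= mulr_sumr; congr (_ + _).
  case: eqP => _ /=; rewrite ?big_nil //; case: ifP => _; rewrite big_seq1 /=.
    by rewrite word_val_cons word_val_nil mulr1 mulN1r.
  by rewrite word_val_nil mulr1.
by apply: eq_bigr => c _; rewrite word_val_cons !mulrzl mulrzAr.
Qed.

Lemma fox_val_cat x u v :
  fox_val N x (u ++ v) = fox_val N x u + word_val N u * fox_val N x v.
Proof.
elim: u => [|l u IHu]; first by rewrite fox_val_nil word_val_nil mul1r add0r.
by rewrite cat_cons !fox_val_cons IHu word_val_cons mulrDr addrA mulrA.
Qed.

Lemma fox_val_pow x n u :
  fox_val N x (flatten (nseq n u)) =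
    (\sum_(i < n) word_val N u ^+ i) * fox_val N x u.
Proof.
elim: n => [|n IHn] /=; first by rewrite fox_val_nil big_ord0 mul0r.
rewrite fox_val_cat IHn big_ord_recl expr0 mulrDl mul1r; congr (_ + _).
rewrite mulrA; congr (_ * _); rewrite mulr_sumr.
by apply: eq_bigr => i _; rewrite -exprS.
Qed.

End UnitRing.

Lemma rmorph_fox_val (S S' : unitRingType) (N : X -> S)
    (f : {rmorphism S -> S'}) x u :
  (forall g, N g \is a GRing.unit) ->
  fox_val (f \o N) x u = f (fox_val N x u).
Proof.
move=> N_unit; have fE l : letter_val (f \o N) l = f (letter_val N l).
  by rewrite /letter_val; case: ifP => _ //=; rewrite rmorphV.
elim: u => [|l u IHu]; first by rewrite !fox_val_nil rmorph0.
rewrite !fox_val_cons IHu rmorphD rmorphM fE; congr (_ + _).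
by case: ifP => _; [rewrite rmorph0 | case: ifP; rewrite ?rmorphN ?rmorph1].
Qed.

(** The rows of [Q] span a space stable under right multiplication by every [M g], on which [M] acts
    through [N]. Invertibility lets [Q M = N Q] pass to inverses, hence to all words and their
    combinations. *)
Lemma comb_mx_intertwine (F : fieldType) (m n : nat) (M : X -> 'M[F]_n)
    (N : X -> 'M[F]_m.+1) (Q : 'M[F]_(m.+1, n)) s :
  (forall g, M g \in unitmx) -> (forall g, N g \is a GRing.unit) ->
  (forall g, Q *m M g = N g *m Q) ->
  Q *m comb_mx M s = comb_val N s *m Q.
Proof.
move=> M_unit N_unit QMN; have wE u : Q *m word_mx M u = word_val N u *m Q.
  elim: u => [|l u IHu]; first by rewrite word_val_nil mulmx1 mul1mx.
  rewrite word_val_cons /= mulmxA.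
  suff -> : Q *m (if l.2 then invmx (M l.1) else M l.1) = letter_val N l *m Q.
    by rewrite -mulmxA IHu mulmxA.
  rewrite /letter_val; case: ifP => _ //.
  apply: (can_inj (mulmxK (M_unit l.1))); rewrite mulmxKV // -mulmxA QMN mulmxA.
  by rewrite -[_ *m N _]/(_^-1 * _) mulVr // mul1mx.
rewrite /comb_mx /comb_val mulmx_suml mulmx_sumr; apply: eq_bigr => c _.
by rewrite -scalemxAr wE scalemxAl mulrzl scaler_int.
Qed.

End FoxEvaluation.

(** * Block decomposition of the knot word *)

Definition alt_word (x s : bool) (n : nat) : word bool :=
  [seq (x (+) odd i, s) | i <- iota 0 n].

Lemma alt_word_even x s n :
  alt_word x s (n * 2) = flatten (nseq n [:: (x, s); (~~ x, s)]).
Proof.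
elim: n => [//|n IHn]; rewrite mulSn /= -IHn /alt_word iotaD map_cat /=.
rewrite addbF addbT; congr [:: _, _ & _]; rewrite (iotaDl 2 0) -map_comp.
by apply: eq_map => i /=; rewrite negbK.
Qed.

Lemma alt_word_odd x s n :
  alt_word x s (n * 2).+1 = flatten (nseq n [:: (x, s); (~~ x, s)]) ++ [:: (x, s)].
Proof.
by rewrite -alt_word_even /alt_word -addn1 iotaD map_cat /= oddM andbF addbF.
Qed.

(* [gen_b] is [true], and [eps p q i = -1] exactly when the quotient is odd. *)
Definition knot_letter (p q i : nat) : letter bool := (odd i, odd (i * p %/ q)).

Lemma knot_wordE p q :
  knot_word p q = [seq knot_letter p q i | i <- iota 1 q.-1].
Proof.
apply: eq_map => i; rewrite /knot_letter /eps -signr_odd; congr (_, _).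
  by case: (odd i).
by case: (odd _).
Qed.

Lemma knot_letter_run p q s n m :
  (forall d, (d < n)%N -> ((s + d) * p %/ q)%N = m) ->
  [seq knot_letter p q i | i <- iota s n] = alt_word (odd s) (odd m) n.
Proof.
move=> sm; rewrite -[s in iota s]addn0 iotaDl -map_comp; apply/eq_in_map => d.
by rewrite mem_iota /= add0n => /sm dm; rewrite /knot_letter dm oddD.
Qed.

Lemma knot_letter_runs p q s L m n :
  odd L ->
  (forall i d, (i < n.*2)%N -> (d < L)%N ->
     ((s + i * L + d) * p %/ q)%N = (m + i)%N) ->
  [seq knot_letter p q i | i <- iota s (n * L.*2)] =
  flatten (nseq n (alt_word (odd s) (odd m) L ++ alt_word (~~ odd s) (~~ odd m) L)).
Proof.
move=> oddL; elim: n s m => [//|n IHn] s m sm.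
rewrite mulSn -{1}addnn -addnA iotaD map_cat iotaD map_cat -addnA addnn /= -catA.
congr (_ ++ _).
  apply: knot_letter_run => d ltdL.
  by have := sm 0%N d isT ltdL; rewrite mul0n !addn0.
congr (_ ++ _).
  rewrite (@knot_letter_run _ _ _ _ m.+1) => [|d ltdL]; first by rewrite oddD oddL addbT.
  by have := sm 1%N d isT ltdL; rewrite mul1n addn1.
rewrite (IHn _ m.+2) => [|i d lti ltd]; first by rewrite oddD odd_double addbF /= negbK.
have := sm i.+2 d; rewrite doubleS !ltnS => /(_ lti ltd).
by rewrite !mulSn -addnn !addnA !addnS.
Qed.

(** For [q = p L + 4] one has [(m L + c + d) p = m q + ((c + d) p - 4 m)], and the two hypotheses
    say that the last term is a remainder, in [[0, q)]. *)
Lemma div_run p L m c d :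
  (4 * m <= (c + d) * p)%N -> ((c + d) * p < L * p + 4 * m.+1)%N ->
  ((m * L + c + d) * p %/ (p * L + 4))%N = m.
Proof.
move=> lo hi; have -> : ((m * L + c + d) * p = m * (p * L + 4) + ((c + d) * p - 4 * m))%N.
  by nia.
by rewrite divnMDl ?addn4 // divn_small ?addn0 //; nia.
Qed.

Lemma knot_word_decomp (k j p q L : nat) :
  p = (5 + 24 * j)%N -> L = (6 * k).+1 -> q = (p * L + 4)%N ->
  knot_word p q =
    flatten (nseq (3 * j) (alt_word true false L ++ alt_word false true L))
    ++ alt_word true false L ++ alt_word false true L.+1
    ++ flatten (nseq (3 * j) (alt_word false false L ++ alt_word true true L))
    ++ alt_word false false L.+1
    ++ flatten (nseq (3 * j) (alt_word false true L ++ alt_word true false L))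
    ++ alt_word false true L.+1
    ++ flatten (nseq (3 * j) (alt_word false false L ++ alt_word true true L))
    ++ alt_word false false L.
Proof.
move=> pE LE qE; rewrite knot_wordE.
have oddL : odd L by lia.
have run m c n x y : odd (m + c) = x -> odd m = y -> (4 * m <= c * p)%N ->
    ((c + n) * p < (L + 1) * p + 4 * m.+1)%N ->
    [seq knot_letter p q i | i <- iota (m * L + c) n] = alt_word x y n.
  move=> parx <- lo hi; rewrite (knot_letter_run p q _ _ m) => [|d ltd].
    by rewrite oddD oddM oddL andbT -oddD parx.
  by rewrite qE div_run //; nia.
(* Over [6 j] consecutive blocks the lower bound of [div_run] is tightest at the first letter of the
   last block, the upper bound at the last letter of the first block. *)
have runs m c x y : odd (m + c) = x -> odd m = y -> (4 * (m + 6 * j) <= c * p + 4)%N ->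
    (c * p < p + 4 * m.+1)%N ->
    [seq knot_letter p q i | i <- iota (m * L + c) (3 * j * L.*2)] =
    flatten (nseq (3 * j) (alt_word x y L ++ alt_word (~~ x) (~~ y) L)).
  move=> parx <- lo hi; rewrite (knot_letter_runs p q _ L m) // => [|i d lti ltd].
    by rewrite oddD oddM oddL andbT -oddD parx.
  have -> : (m * L + c + i * L + d = (m + i) * L + c + d)%N by lia.
  by rewrite qE div_run //; nia.
have -> : q.-1 = (3 * j * L.*2 + (L + (L.+1 + (3 * j * L.*2 + (L.+1 + (3 * j * L.*2
   + (L.+1 + (3 * j * L.*2 + L))))))))%N by nia.
(* Each segment starts at [m * L + c], where [m] counts the blocks before it and [c] is one more
   than the number of lengthened blocks among them. *)
have s1 : (1 + 3 * j * L.*2 = 6 * j * L + 1)%N by nia.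
have s2 : (6 * j * L + 1 + L = (6 * j + 1) * L + 1)%N by nia.
have s3 : ((6 * j + 1) * L + 1 + L.+1 = (6 * j + 2) * L + 2)%N by nia.
have s4 : ((6 * j + 2) * L + 2 + 3 * j * L.*2 = (12 * j + 2) * L + 2)%N by nia.
have s5 : ((12 * j + 2) * L + 2 + L.+1 = (12 * j + 3) * L + 3)%N by nia.
have s6 : ((12 * j + 3) * L + 3 + 3 * j * L.*2 = (18 * j + 3) * L + 3)%N by nia.
have s7 : ((18 * j + 3) * L + 3 + L.+1 = (18 * j + 4) * L + 4)%N by nia.
have s8 : ((18 * j + 4) * L + 4 + 3 * j * L.*2 = (24 * j + 4) * L + 4)%N by nia.
rewrite !iotaD !map_cat s1 s2 s3 s4 s5 s6 s7 s8.
congr (_ ++ _); first by rewrite -(runs 0 1 true false)%N //; lia.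
congr (_ ++ _); first by apply: run; lia.
congr (_ ++ _); first by apply: run; lia.
congr (_ ++ _); first by rewrite -(runs (6 * j + 2) 2 false false)%N //; lia.
congr (_ ++ _); first by apply: run; lia.
congr (_ ++ _); first by rewrite -(runs (12 * j + 3) 3 false true)%N //; lia.
congr (_ ++ _); first by apply: run; lia.
congr (_ ++ _); first by rewrite -(runs (18 * j + 4) 4 false false)%N //; lia.
by apply: run; lia.
Qed.

(** * The Alexander polynomial in closed form *)

(** The even positions carry the letters [a]. The terms just before and after such a letter [a^e]
    differ by [t^s (t^e - 1)], with [s] the exponent sum so far; this is [t - 1] times the
    contribution of that letter to the Fox derivative, since [t^-1 - 1 = (t - 1) (- t^-1)]. *)
Lemma alternating_sum_fox (K : fieldType) (t : K) (p q n : nat) :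
  t != 0 ->
  \sum_(m < n.*2.+1) (-1) ^+ m * t ^ (\sum_(1 <= i < m.+1) eps p q i) =
  1 + (t - 1) * fox_val (fun _ => t) gen_a [seq knot_letter p q i | i <- iota 1 n.*2].
Proof.
move=> tN0; pose w n := [seq knot_letter p q i | i <- iota 1 n].
have wS i : w i.+1 = w i ++ [:: knot_letter p q i.+1].
  by rewrite /w -[in LHS](addn1 i) iotaD map_cat add1n.
have lE i : letter_val (fun _ => t) (knot_letter p q i) = t ^ eps p q i.
  by rewrite /letter_val /knot_letter /eps -signr_odd /=; case: (odd _) => /=.
have valE i : word_val (fun _ => t) (w i) = t ^ (\sum_(1 <= l < i.+1) eps p q l).
  elim: i => [|i IHi]; first by rewrite big_geq // word_val_nil expr0z.
  rewrite wS word_val_cat IHi word_val_cons word_val_nil mulr1 lE.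
  by rewrite (big_nat_recr i.+1) //= expfzDr.
rewrite -/(w _); elim: n => [|n IHn].
  by rewrite big_ord_recl big_ord0 big_geq // fox_val_nil mulr0 !addr0 mul1r.
rewrite doubleS 2!big_ord_recr IHn /= -!(signr_odd _ _.+1) -signr_odd /= odd_double.
set k := n.*2.
rewrite !wS -!catA !fox_val_cat !fox_val_cons !fox_val_nil /= odd_double /=.
rewrite !word_val_cons word_val_nil !mulr1 !lE valE.
rewrite (big_nat_recr k.+2) // (big_nat_recr k.+1) //= !expfzDr //.
set x := t ^ (\sum_(1 <= i < k.+1) eps p q i).
set y := t ^ eps p q k.+1; set z := t ^ eps p q k.+2.
have zE : z = if odd (k.+2 * p %/ q) then t^-1 else t.
  by rewrite /z -lE /letter_val.
rewrite zE expr0 expr1; case: ifP => _; first by field.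
by ring.
Qed.

Lemma alexander_polyE (C : fieldType) (p q : nat) :
  odd q ->
  alexander_poly C p q =
    1 + (tvar C - 1) * fox_val (fun _ => tvar C) gen_a (knot_word p q).
Proof.
move=> odd_q; have qE : q = q./2.*2.+1 by rewrite -[LHS]odd_double_half odd_q.
have q1E : q.-1 = q./2.*2 by rewrite [in LHS]qE.
rewrite knot_wordE q1E -alternating_sum_fox -?qE //.
by rewrite tofrac_eq0 polyX_eq0.
Qed.

Section AltWord.
Variables (S : unitRingType) (N : bool -> S).
Let l x s := letter_val N (x, s).

Lemma word_val_alt_even x s n :
  word_val N (alt_word x s (n * 2)) = (l x s * l (~~ x) s) ^+ n.
Proof.
by rewrite alt_word_even word_val_pow !word_val_cons word_val_nil mulr1.
Qed.

Lemma word_val_alt_odd x s n :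
  word_val N (alt_word x s (n * 2).+1) = (l x s * l (~~ x) s) ^+ n * l x s.
Proof.
rewrite alt_word_odd -alt_word_even word_val_cat word_val_alt_even.
by rewrite word_val_cons word_val_nil mulr1.
Qed.

(** Each pair contains exactly one letter on [a]; the two conditionals are its prefix inside the
    pair and its own derivative. *)
Lemma fox_val_alt_even x s n :
  fox_val N gen_a (alt_word x s (n * 2)) =
  (\sum_(i < n) (l x s * l (~~ x) s) ^+ i)
    * (if x then l x s else 1) * (if s then - l false s else 1).
Proof.
rewrite alt_word_even fox_val_pow !word_val_cons word_val_nil mulr1 -mulrA.
congr (_ * _); rewrite !fox_val_cons fox_val_nil.
by case: x; case: s; rewrite /= !(mulr0, addr0, add0r, mul1r, mulr1).
Qed.

Lemma fox_val_alt_odd x s n :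
  fox_val N gen_a (alt_word x s (n * 2).+1) =
  fox_val N gen_a (alt_word x s (n * 2))
  + (l x s * l (~~ x) s) ^+ n * (if x then 0 else if s then - l false s else 1).
Proof.
rewrite alt_word_odd -alt_word_even fox_val_cat word_val_alt_even.
rewrite fox_val_cons fox_val_nil mulr0 addr0.
by case: x; case: s.
Qed.

End AltWord.

Lemma geometric_sum (K : fieldType) (x : K) n :
  x != 1 -> \sum_(i < n) x ^+ i = (1 - x ^+ n) / (1 - x).
Proof.
move=> x1; rewrite -opprB subrX1 -(opprB x) invrN mulrNN mulrAC mulfV ?mul1r //.
by rewrite subr_eq0.
Qed.

(** This is [t * Delta] at [x = t], [y = t^(6k)], [J = j], with [S] standing for
    [(x^2 y - 1) / (x^2 - 1)]. Keeping [S] as an argument avoids division, so the form also makes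
    sense over the integer polynomials and commutes with ring morphisms. *)
Definition alexander_form {A : pzRingType} (x y S J : A) : A :=
  x + (x - 1) * ((x ^+ 2 - x *+ 2 + 2) * S - x ^+ 2 * y
                 + 6 * J * (x - 1) * ((x - 1) * S - x * y)).

Lemma rmorph_alexander_form (A B : pzRingType) (h : {rmorphism A -> B}) (x y S J : A) :
  h (alexander_form x y S J) = alexander_form (h x) (h y) (h S) (h J).
Proof.
by rewrite /alexander_form !(rmorphD, rmorphN, rmorphM, rmorphMn, rmorphXn, rmorph1).
Qed.

Lemma fox_scalar (K : fieldType) (t : K) (k j p q : nat) :
  p = (5 + 24 * j)%N -> q = (p * (6 * k).+1 + 4)%N -> t != 0 -> t ^+ 2 != 1 ->
  let u := t ^+ (6 * k) in
  forall S, (t ^+ 2 - 1) * S = t ^+ 2 * u - 1 ->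
  t * (1 + (t - 1) * fox_val (fun _ => t) gen_a (knot_word p q)) =
  alexander_form t u S j%:R.
Proof.
move=> pE qE tN0 t2 u S SE.
rewrite (knot_word_decomp k j p q (6 * k).+1 pE erefl qE).
have -> : (6 * k = 3 * k * 2)%N by lia.
have -> : (3 * k * 2).+2 = ((3 * k).+1 * 2)%N by [].
have uE : (t * t) ^+ (3 * k) = u by rewrite -expr2 -exprM /u; congr (_ ^+ _); lia.
have uVE : (t^-1 * t^-1) ^+ (3 * k) = u^-1 by rewrite -invfM exprVn uE.
have uN0 : u != 0 by rewrite expf_neq0.
have t2' : t ^+ 2 - 1 != 0 by rewrite subr_eq0.
have {SE} -> : S = (t ^+ 2 * u - 1) / (t ^+ 2 - 1) by rewrite -SE mulrC mulKf.
have sE n : \sum_(i < n) (t * t) ^+ i = (1 - (t * t) ^+ n) / (1 - t * t).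
  by rewrite geometric_sum // -expr2.
have sVE n : \sum_(i < n) (t^-1 * t^-1) ^+ i = (1 - (t^-1 * t^-1) ^+ n) / (1 - t^-1 * t^-1).
  by rewrite geometric_sum // -invfM -expr2 invr_eq1.
rewrite !fox_val_cat !fox_val_pow !word_val_pow !word_val_cat.
rewrite !fox_val_cat !word_val_alt_odd !fox_val_alt_odd !word_val_alt_even !fox_val_alt_even.
rewrite /letter_val /= !sE !sVE !(exprSr _ (3 * k)) !uE !uVE.
(* At [a = b = t] the two blocks of a repeated piece have inverse values, so the piece has value 1
   and its powers add up to [3 j]. *)
have jE x : x = 1 -> \sum_(i < 3 * j) x ^+ i = 3 * j%:R :> K.
  move=> ->; under eq_bigr do rewrite expr1n.
  by rewrite sumr_const card_ord natrM.
have pE1 x : x = 1 -> x ^+ (3 * j) = 1 :> K by move=> ->; rewrite expr1n.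
have TV : u * t * (u^-1 / t) = 1 by field; rewrite uN0 tN0.
have VT : u^-1 / t * (u * t) = 1 by rewrite mulrC.
(* What remains is an identity of rational functions in independent [t], [u] and [J]. *)
rewrite !jE // !pE1 // /alexander_form; clearbody u; clear -tN0 uN0 t2'.
move: (j%:R) => J; field.
by rewrite tN0 uN0 t2' -expr2 -opprB oppr_eq0 t2'.
Qed.

(** * The two-dimensional representation and its determinant *)

Definition mat2 {K : fieldType} (a b c d : K) : 'M[K]_2 :=
  \matrix_(i < 2, j < 2)
    if i == 0 then (if j == 0 then a else b) else (if j == 0 then c else d).

Section Mat2.
Variable K : fieldType.
Implicit Types a b c d x t : K.

Lemma mat2M a b c d a' b' c' d' :
  mat2 a b c d * mat2 a' b' c' d' =
  mat2 (a * a' + b * c') (a * b' + b * d') (c * a' + d * c') (c * b' + d * d').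
Proof.
apply/matrixP => i j; rewrite !mxE !big_ord_recl big_ord0 !mxE addr0.
by case: i => -[|[|//]] ?; case: j => -[|[|//]] ?.
Qed.

Lemma mat2D a b c d a' b' c' d' :
  mat2 a b c d + mat2 a' b' c' d' = mat2 (a + a') (b + b') (c + c') (d + d').
Proof.
by apply/matrixP => i j; rewrite !mxE; case: eqP; case: eqP.
Qed.

Lemma mat2N a b c d : - mat2 a b c d = mat2 (- a) (- b) (- c) (- d).
Proof.
by apply/matrixP => i j; rewrite !mxE; case: eqP; case: eqP.
Qed.

Lemma mat2_scalar x : x%:M = mat2 x 0 0 x.
Proof.
apply/matrixP => i j; rewrite !mxE.
by case: i => -[|[|//]] ?; case: j => -[|[|//]] ?.
Qed.

Lemma det_mat2 a b c d : \det (mat2 a b c d) = a * d - b * c.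
Proof.
rewrite (expand_det_row _ ord0) !big_ord_recl big_ord0 /cofactor !det_mx11 !mxE /=.
by rewrite expr0 expr1; ring.
Qed.

Lemma mat2V a b c d a' b' c' d' :
  mat2 a b c d * mat2 a' b' c' d' = 1 -> (mat2 a b c d)^-1 = mat2 a' b' c' d'.
Proof.
move=> xy1; have U : mat2 a b c d \is a GRing.unit by case/mulmx1_unit: xy1.
by apply: (mulrI U); rewrite mulrV.
Qed.

End Mat2.

(** Exponents are grouped in triples. If [x ^+ 3] is scalar, a scalar geometric sum is left; if
    [1 + x + x ^+ 2 = 0], the sum vanishes. *)
Lemma sum_expr_cube (S : pzRingType) (x : S) n :
  \sum_(i < 3 * n) x ^+ i = (\sum_(i < n) (x ^+ 3) ^+ i) * (1 + x + x ^+ 2).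
Proof.
elim: n => [|n IHn]; first by rewrite !big_ord0 mul0r.
rewrite mulnS addnC !addnS addn0 !big_ord_recr IHn /= mulrDl -!addrA.
by rewrite -exprM !mulrDr !mulr1 -exprSr -exprD addn2 !addrA.
Qed.

(* [t] times the action of two distinct reflections, with fixed coordinates [x] and
   [y], on the span of the linear forms [e_y - e_z] and [e_x - e_z]. *)
Section QuotientRep.
Context {K : fieldType} (t : K).

Definition quot_rep (g : bool) : 'M[K]_2 :=
  if g then mat2 t (- t) 0 (- t) else mat2 (- t) 0 (- t) t.

End QuotientRep.

Lemma fox_quot_rep (K : fieldType) (t : K) (k j p q : nat) :
  p = (5 + 24 * j)%N -> q = (p * (6 * k).+1 + 4)%N -> t != 0 -> t ^+ 6 != 1 ->
  let u := t ^+ (6 * k) in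
  \det (1 + (quot_rep t gen_a - 1) * fox_val (quot_rep t) gen_a (knot_word p q))
  = - (t ^+ 2 - 1) ^+ 2 / t ^+ 2 * ((1 - u ^+ 2 * t ^+ 6) / (1 - t ^+ 6)).
Proof.
move=> pE qE tN0 t6 u.
rewrite (knot_word_decomp k j p q (6 * k).+1 pE erefl qE).
have -> : (6 * k = 3 * k * 2)%N by lia.
have -> : (3 * k * 2).+2 = ((3 * k).+1 * 2)%N by [].
have uN0 : u != 0 by rewrite expf_neq0.
have t6' : 1 - t ^+ 6 != 0 by rewrite subr_eq0 eq_sym.
have oneE : (1 : 'M[K]_2) = mat2 1 0 0 1 by rewrite -mat2_scalar.
have zeroE : (0 : 'M[K]_2) = mat2 0 0 0 0 by rewrite -mat2_scalar raddf0.
pose al := quot_rep t gen_a; pose be := quot_rep t gen_b.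
have alV : al^-1 = mat2 (- t^-1) 0 (- t^-1) t^-1.
  by apply: mat2V; rewrite mat2M oneE; congr mat2; field.
have beV : be^-1 = mat2 t^-1 (- t^-1) 0 (- t^-1).
  by apply: mat2V; rewrite mat2M oneE; congr mat2; field.
have abE : al * be = mat2 (- t ^+ 2) (t ^+ 2) (- t ^+ 2) 0.
  by rewrite mat2M; congr mat2; ring.
have baE : be * al = mat2 0 (- t ^+ 2) (t ^+ 2) (- t ^+ 2).
  by rewrite mat2M; congr mat2; ring.
have abVE : al^-1 * be^-1 = mat2 (- t ^- 2) (t ^- 2) (- t ^- 2) 0.
  by rewrite alV beV mat2M; congr mat2; field.
have baVE : be^-1 * al^-1 = mat2 0 (- t ^- 2) (t ^- 2) (- t ^- 2).
  by rewrite alV beV mat2M; congr mat2; field.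
(* [al * be] is [t ^+ 2] times a rotation of order 3, so its cube is scalar; likewise for the other
   order and for the inverses. *)
have ab3 : (al * be) ^+ 3 = (t ^+ 6)%:M.
  by rewrite abE !exprSr expr0 mul1r mat2_scalar !mat2M; congr mat2; ring.
have ba3 : (be * al) ^+ 3 = (t ^+ 6)%:M.
  by rewrite baE !exprSr expr0 mul1r mat2_scalar !mat2M; congr mat2; ring.
have abV3 : (al^-1 * be^-1) ^+ 3 = (t ^- 6)%:M.
  by rewrite abVE !exprSr expr0 mul1r mat2_scalar !mat2M; congr mat2; field.
have baV3 : (be^-1 * al^-1) ^+ 3 = (t ^- 6)%:M.
  by rewrite baVE !exprSr expr0 mul1r mat2_scalar !mat2M; congr mat2; field.
have cubeE (x : 'M[K]_2) y : x ^+ 3 = y%:M -> x ^+ (3 * k) = (y ^+ k)%:M.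
  by move=> xE; rewrite exprM xE rmorphXn.
have sumE (x : 'M[K]_2) y : x ^+ 3 = y%:M -> y != 1 ->
   \sum_(i < 3 * k) x ^+ i = ((1 - y ^+ k) / (1 - y))%:M * (1 + x + x ^+ 2).
  move=> xE y1; rewrite sum_expr_cube xE -geometric_sum // rmorph_sum /=.
  by under eq_bigr do rewrite -rmorphXn.
have t6V : t ^- 6 != 1 by rewrite invr_eq1.
have uE : (t ^+ 6) ^+ k = u by rewrite -exprM.
have uVE : (t ^- 6) ^+ k = u^-1 by rewrite exprVn uE.
have jE (x : 'M[K]_2) : 1 + x + x ^+ 2 = 0 -> \sum_(i < 3 * j) x ^+ i = 0.
  by move=> xE; rewrite sum_expr_cube xE mulr0.
have powE (x : 'M[K]_2) : 1 + x + x ^+ 2 = 0 -> x ^+ (3 * j) = 1.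
  move=> xE; have : x ^+ 3 - 1 = 0.
    by rewrite subrX1 3!big_ord_recl big_ord0 addr0 expr0 expr1 /= addrA xE mulr0.
  by move/eqP; rewrite subr_eq0 => /eqP x3; rewrite exprM x3 expr1n.
rewrite !fox_val_cat !fox_val_pow !word_val_pow !word_val_cat.
rewrite !fox_val_cat !word_val_alt_odd !fox_val_alt_odd !word_val_alt_even !fox_val_alt_even.
rewrite /letter_val.
have -> : quot_rep t (true, false).1 = be by [].
have -> : quot_rep t gen_a = al by [].
cbn [negb fst snd].
have ab3k : (al * be) ^+ (3 * k) = u%:M by rewrite (cubeE _ _ ab3) uE.
have ba3k : (be * al) ^+ (3 * k) = u%:M by rewrite (cubeE _ _ ba3) uE.
have abV3k : (al^-1 * be^-1) ^+ (3 * k) = (u^-1)%:M by rewrite (cubeE _ _ abV3) uVE.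
have baV3k : (be^-1 * al^-1) ^+ (3 * k) = (u^-1)%:M by rewrite (cubeE _ _ baV3) uVE.
rewrite !big_ord_recr /= !(exprSr _ (3 * k)) ab3k ba3k abV3k baV3k.
(* The scalars [u] and [u^-1] cancel in a repeated piece; what is left is one reflection times the
   inverse of the other, a rotation of order 3. *)
have x1 : 1 + u%:M * be * ((u^-1)%:M * al^-1) + (u%:M * be * ((u^-1)%:M * al^-1)) ^+ 2 = 0.
  rewrite oneE alV /be /= !mat2_scalar expr2 !mat2M !mat2D [RHS]zeroE.
  by congr mat2; field; rewrite tN0 uN0.
have x2 : 1 + u%:M * al * ((u^-1)%:M * be^-1) + (u%:M * al * ((u^-1)%:M * be^-1)) ^+ 2 = 0.
  rewrite oneE beV /al /= !mat2_scalar expr2 !mat2M !mat2D [RHS]zeroE.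
  by congr mat2; field; rewrite tN0 uN0.
have x3 : 1 + (u^-1)%:M * al^-1 * (u%:M * be) + ((u^-1)%:M * al^-1 * (u%:M * be)) ^+ 2 = 0.
  rewrite oneE alV /be /= !mat2_scalar expr2 !mat2M !mat2D [RHS]zeroE.
  by congr mat2; field; rewrite tN0 uN0.
rewrite (jE _ x1) (jE _ x2) (jE _ x3) (powE _ x1) (powE _ x2) (powE _ x3).
rewrite !mul0r !mulr0 !add0r !addr0 !mulr1 !mul1r.
rewrite (sumE _ _ ab3 t6) (sumE _ _ ba3 t6) (sumE _ _ abV3 t6V) uE uVE.
rewrite abE baE abVE alV /al /be /= oneE !mat2_scalar !expr2.
rewrite !(mat2M, mat2D, mat2N) det_mat2.
clearbody u; clear -tN0 uN0 t6'.
have t6'' : t ^+ 6 - 1 != 0 by rewrite -opprB oppr_eq0.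
field.
by rewrite tN0 uN0 t6' t6''.
Qed.

(** * Splitting off the trivial summand *)

Section Reflections.
Variable K : fieldType.

Definition refl_mx (m : nat) : 'M[K]_3 :=
  \matrix_(i < 3, j < 3) ((i + j + m) %% 3 == 2)%N%:R.

Let row_1 : 'M[K]_(1, 3) := const_mx 1.

Let quot_mx (x y z : nat) : 'M[K]_(2, 3) :=
  \matrix_(i < 2, j < 3)
    ((j == (if i == 0 :> nat then y else x) :> nat)%:R - (j == z :> nat)%:R).

(* The reflection [refl_mx m] fixes the coordinate [m + 1] modulo 3. *)
Lemma reflections_split (m m' : nat) :
  (m < 3)%N -> (m' < 3)%N -> m != m' -> (3%:R : K) != 0 ->
  exists Q : 'M[K]_(2, 3),
    [/\ Q *m refl_mx m = quot_rep 1 gen_a *m Q,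
        Q *m refl_mx m' = quot_rep 1 gen_b *m Q &
        col_mx row_1 Q \in unitmx].
Proof.
move=> lt_m lt_m' neq_m n3.
(* As [0 + 1 + 2 = 3], the third argument is the coordinate fixed by neither reflection. *)
exists (quot_mx (m.+1 %% 3) (m'.+1 %% 3) (3 - (m.+1 %% 3 + m'.+1 %% 3))); split.
- case: m lt_m neq_m => [|[|[|//]]] _; case: m' lt_m' => [|[|[|//]]] _ // _;
  apply/matrixP => i j; rewrite !mxE !big_ord_recl !big_ord0 !mxE /=;
  case: i => -[|[|//]] ?; case: j => -[|[|[|//]]] ? /=; ring.
- case: m lt_m neq_m => [|[|[|//]]] _; case: m' lt_m' => [|[|[|//]]] _ // _;
  apply/matrixP => i j; rewrite !mxE !big_ord_recl !big_ord0 !mxE /=;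
  case: i => -[|[|//]] ?; case: j => -[|[|[|//]]] ? /=; ring.
set Q := quot_mx _ _ _.
(* Invertibility is read off the Gram matrix: the all-ones row is orthogonal to [Q], and the
   determinant is [3 * 3]. *)
have Q1 : row_1 *m Q^T = 0.
  apply/matrixP => i j; rewrite !mxE !big_ord_recl !big_ord0 !mxE /=.
  case: m lt_m neq_m {Q} => [|[|[|//]]] _; case: m' lt_m' => [|[|[|//]]] _ // _;
  case: j => -[|[|//]] ? /=; ring.
have QQ : Q *m Q^T = mat2 2 1 1 2.
  apply/matrixP => i j; rewrite !mxE !big_ord_recl !big_ord0 !mxE /=.
  case: m lt_m neq_m {Q Q1} => [|[|[|//]]] _; case: m' lt_m' => [|[|[|//]]] _ // _;
  case: i => -[|[|//]] ?; case: j => -[|[|//]] ? /=; ring.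
have PP : col_mx row_1 Q *m (col_mx row_1 Q)^T = block_mx 3%:M 0 0 (mat2 2 1 1 2).
  rewrite tr_col_mx mul_col_row Q1 QQ -[Q *m row_1^T]trmxK trmx_mul trmxK Q1 trmx0.
  congr block_mx; apply/matrixP => i j.
  rewrite !ord1 !mxE !big_ord_recl big_ord0 !mxE /=; ring.
have : \det (col_mx row_1 Q *m (col_mx row_1 Q)^T) != 0.
  rewrite PP (@det_ublock _ 1 2) det_scalar1 det_mat2.
  have -> : 3 * (2 * 2 - 1 * 1) = 3%:R * 3%:R :> K by ring.
  by rewrite mulf_neq0.
by rewrite det_mulmx mulf_eq0 negb_or unitmxE unitfE => /andP[].
Qed.

Lemma row_1_refl (m : nat) : row_1 *m refl_mx m = row_1.
Proof.
have -> : refl_mx m = refl_mx (m %% 3).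
  by apply/matrixP => i j; rewrite !mxE modnDmr.
have lt3 : (m %% 3 < 3)%N by rewrite ltn_mod.
apply/matrixP => i j; rewrite !mxE !big_ord_recl !big_ord0 !mxE /=.
by case: (m %% 3)%N lt3 => [|[|[|//]]] _; case: j => -[|[|[|//]]] ? /=; ring.
Qed.
End Reflections.

Lemma quot_repE (K : fieldType) (t : K) g : quot_rep t g = t *: quot_rep 1 g.
Proof.
by apply/matrixP => i j; case: g; rewrite !mxE;
  case: eqP => _; case: eqP => _; ring.
Qed.

(** In the basis of [reflections_split] both generators are block diagonal, hence so are the
    evaluated Fox derivatives, and each determinant is the product over the two summands. *)
Lemma det_reflections (K : fieldType) (t : K) (M : bool -> 'M[K]_3) (m m' : nat)
    (w : word bool) :
  (m < 3)%N -> (m' < 3)%N -> m != m' -> (3%:R : K) != 0 -> t != 0 ->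
  M gen_a = t *: refl_mx K m -> M gen_b = t *: refl_mx K m' ->
  \det (1%:M + (M gen_a - 1%:M) *m comb_mx M (fox_deriv gen_a w)) =
    (1 + (t - 1) * fox_val (fun _ => t) gen_a w)
    * \det (1 + (quot_rep t gen_a - 1) * fox_val (quot_rep t) gen_a w)
  /\ \det (M gen_b - 1%:M) = (t - 1) * (1 - t ^+ 2).
Proof.
move=> lt_m lt_m' neq_m n3 tN0 Ma Mb.
have [Q [Qa Qb P_unit]] := reflections_split K m m' lt_m lt_m' neq_m n3.
set r := const_mx 1 in P_unit; set P := col_mx r Q in P_unit.
have rM g : r *m M g = (t%:M : 'M[K]_1) *m r.
  by rewrite mul_scalar_mx; case: g; rewrite ?Ma ?Mb -scalemxAr row_1_refl.
have QM g : Q *m M g = quot_rep t g *m Q.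
  by rewrite quot_repE; case: g; rewrite ?Ma ?Mb -scalemxAr -scalemxAl ?Qa ?Qb.
have det_block (X : 'M[K]_3) (x : K) (Y : 'M[K]_2) :
    r *m X = x%:M *m r -> Q *m X = Y *m Q -> \det X = x * \det Y.
  move=> rX QX; have PX : P *m X = block_mx x%:M 0 0 Y *m P.
    by rewrite mul_col_mx mul_block_col !mul0mx addr0 add0r rX QX.
  have := congr1 (fun A => \det A) PX.
  rewrite /= !det_mulmx (@det_ublock _ 1 2) det_scalar1 mulrC => /mulIf -> //.
  by move: P_unit; rewrite unitmxE unitfE.
have N_unit g : quot_rep t g \is a GRing.unit.
  rewrite -[_ \is a _]/(_ \in unitmx) unitmxE unitfE.
  case: g; rewrite det_mat2; [rewrite mulr0 subr0 | rewrite mul0r subr0];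
    by rewrite ?mulrN ?mulNr oppr_eq0 mulf_neq0.
have t_unit (g : bool) : (t%:M : 'M[K]_1) \is a GRing.unit.
  by rewrite -[_ \is a _]/(_ \in unitmx) unitmxE det_scalar1 unitfE.
have M_unit g : M g \in unitmx.
  have /eqP := det_block _ _ _ (rM g) (QM g); rewrite unitmxE unitfE => /eqP ->.
  by rewrite mulf_neq0 // -unitfE -unitmxE; apply: N_unit.
have rB g : r *m (M g - 1%:M) = (t - 1)%:M *m r.
  by rewrite mulmxBr rM mulmx1 raddfB /= mulmxBl mul1mx.
have QB g : Q *m (M g - 1%:M) = (quot_rep t g - 1) *m Q.
  by rewrite mulmxBr mulmxBl QM mulmx1 mul1mx.
split; last first.
  rewrite (det_block _ _ _ (rB _) (QB _)).
  have -> : (1 : 'M[K]_2) = mat2 1 0 0 1 by rewrite -mat2_scalar.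
  by rewrite /= mat2N mat2D det_mat2; congr (_ * _); ring.
apply: det_block; rewrite mulmxDr mulmx1 mulmxA.
  rewrite rB -mulmxA (comb_mx_intertwine _ _ _ _ (fun _ => t%:M)) //.
  rewrite -/(fox_val _ _ _) -[fun _ => t%:M]/(scalar_mx \o (fun _ => t)).
  rewrite (rmorph_fox_val _ _ _ (scalar_mx : {rmorphism K -> 'M[K]_1})); last first.
    by rewrite unitfE.
  by rewrite mulmxA [in RHS]raddfD /= scalar_mxM mulmxDl mul1mx.
rewrite QB -mulmxA (comb_mx_intertwine _ _ _ _ (quot_rep t)) // [in RHS]mulmxDl mulmxA.
by congr (_ + _); rewrite -[LHS]mul1mx.
Qed.

(** * The images of the meridians in the dihedral group *)

Lemma pres_ind (X : choiceType) (rels : seq (word X * word X))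
    (P : presented rels -> Prop) :
  P 1%g -> (forall x g, P g -> P (pres_gen x * g)%g) ->
  (forall x g, P g -> P ((pres_gen x)^-1 * g)%g) -> forall g, P g.
Proof.
move=> P1 PM PV; elim/pres_ofW; elim=> [//|[x s] u IHu].
have -> : pres_of rels ((x, s) :: u) =
    ((if s then (pres_gen x)^-1 else pres_gen x) * pres_of rels u)%g.
  rewrite -cat1s pres_of_cat; case: s => //; congr (_ * _)%g.
  by rewrite -[RHS]pres_of_inv.
by case: s; [apply: PV | apply: PM].
Qed.

Section DihedralRep.
Variable C : fieldType.
Let F : 'M[C]_3 := flip_mx C 3.
Let R : 'M[C]_3 := rot_mx C 3.

Lemma flip_sqr : F * F = 1.
Proof.
apply/matrixP => i j; rewrite !mxE !big_ord_recl !big_ord0 !mxE /=.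
by case: i => -[|[|[|//]]] ?; case: j => -[|[|[|//]]] ? /=; ring.
Qed.

Lemma rot_sqr : R * R = R^T.
Proof.
apply/matrixP => i j; rewrite !mxE !big_ord_recl !big_ord0 !mxE /=.
by case: i => -[|[|[|//]]] ?; case: j => -[|[|[|//]]] ? /=; ring.
Qed.

Lemma rot_cube : R ^+ 3 = 1.
Proof.
rewrite !exprS expr0 mulr1 rot_sqr.
apply/matrixP => i j; rewrite !mxE !big_ord_recl !big_ord0 !mxE /=.
by case: i => -[|[|[|//]]] ?; case: j => -[|[|[|//]]] ? /=; ring.
Qed.

Lemma rot_flip : R * F = F * R ^+ 2.
Proof.
rewrite expr2 rot_sqr.
apply/matrixP => i j; rewrite !mxE !big_ord_recl !big_ord0 !mxE /=.
by case: i => -[|[|[|//]]] ?; case: j => -[|[|[|//]]] ? /=; ring.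
Qed.

Lemma flip_rot (m : nat) : (m < 3)%N -> F * R ^+ m = refl_mx C m.
Proof.
have mxP (A B : 'M[C]_3) : (forall i j : 'I_3, A i j = B i j) -> A = B.
  by move=> AB; apply/matrixP.
case: m => [|[|[|//]]] _; rewrite ?expr0 ?mulr1 ?expr1 ?expr2 ?rot_sqr;
  apply: mxP => i j; rewrite !(mxE, big_ord_recl, big_ord0) /=;
  by case: i => -[|[|[|//]]] ?; case: j => -[|[|[|//]]] ? /=; ring.
Qed.

Lemma rot_neq1 : R != 1.
Proof.
apply/eqP => /matrixP /(_ ord0 ord0); rewrite !mxE /= => /eqP.
by rewrite eq_sym oner_eq0.
Qed.

(** Commuting would give [R = R ^+ 2], hence [R = 1]. This is the contradiction that excludes
    degenerate images of [a] and [b]. *)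
Lemma flip_rot_noncomm : ~ GRing.comm F R.
Proof.
rewrite /GRing.comm rot_flip => FR.
have FU : F \is a GRing.unit by apply/unitrP; exists F; rewrite flip_sqr.
have RU : R \is a GRing.unit by rewrite -(unitrX_pos _ (isT : (0 < 3)%N)) rot_cube unitr1.
move/(mulrI FU)/eqP: FR; rewrite expr2 -{1}[R]mulr1 => /eqP /(mulrI RU)/eqP.
by rewrite eq_sym (negbTE rot_neq1).
Qed.

Lemma det_flip : \det F = -1.
Proof.
have -> : F = perm_mx (tperm ord0 ord_max).
  apply/matrixP => i j; rewrite !mxE permE /=.
  by case: i => -[|[|[|//]]] ?; case: j => -[|[|[|//]]] ?.
by rewrite det_perm odd_tperm.
Qed.

Lemma det_rot : \det R = 1.
Proof.
have := congr1 (fun A => \det A) rot_flip.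
rewrite -![_ * _]/(_ *m _) -[R ^+ 2]/(R *m R) /= !det_mulmx det_flip.
have RU : \det R \is a GRing.unit.
  have := congr1 (fun A => \det A) rot_cube.
  rewrite !exprS expr0 mulr1 -![_ * _]/(_ *m _) /= !det_mulmx det1 => e.
  by apply/unitrP; exists (\det R * \det R); rewrite mulrC e.
by rewrite mulrN1 mulN1r => /oppr_inj; rewrite -{1}[\det R]mulr1 => /(mulrI RU).
Qed.

Variables (pi : dihedral_group 3 -> 'M[C]_3) (p q : nat).
Variable rho : {multiplicative knot_group p q -> dihedral_group 3}.
Hypothesis pi_rep : is_dihedral_rep pi.
Hypothesis rho_surj : forall d, exists g, rho g = d.
Hypothesis two_neq0 : (2%:R : C) != 0.

Lemma pi_dihedralE d :
  exists (e : bool) (m : nat), (m < 3)%N /\ pi d = F ^+ e * R ^+ m.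
Proof.
case: pi_rep => pi1 piM piF piR.
have piV g : pi g * pi g^-1%g = 1 by rewrite -[_ * _]/(_ *m _) -piM mulgV pi1.
have piFV : pi (pres_gen gen_x)^-1%g = F.
  have := piV (pres_gen gen_x); rewrite piF => /(congr1 (fun A => F * A)).
  by rewrite mulrA flip_sqr mul1r mulr1.
have piRV : pi (pres_gen gen_y)^-1%g = R ^+ 2.
  have := piV (pres_gen gen_y); rewrite piR => /(congr1 (fun A => R ^+ 2 * A)).
  by rewrite mulrA -exprSr rot_cube mul1r mulr1.
have normal (e m : nat) : exists (e' : bool) (m' : nat),
    (m' < 3)%N /\ F ^+ e * R ^+ m = F ^+ e' * R ^+ m'.
  exists (odd e), (m %% 3)%N; rewrite ltn_mod expr_mod ?rot_cube //; split=> //.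
  by rewrite -[in LHS](odd_double_half e) exprD -mul2n exprM expr2 flip_sqr expr1n mulr1.
(* Moving a rotation past the flip inverts it, and inverting is doubling the exponent because
   [R ^+ 3 = 1]. *)
have rotF n m : R ^+ n * (F * R ^+ m) = F * R ^+ (2 * n + m).
  rewrite exprD exprM !mulrA; congr (_ * _); elim: n => [|n IHn].
    by rewrite !expr0 mul1r mulr1.
  by rewrite exprS -mulrA IHn mulrA rot_flip -mulrA -exprS.
elim/pres_ind: d => [|x g [e [m [_ gE]]]|x g [e [m [_ gE]]]].
- by exists false, 0%N; rewrite pi1 mulr1.
- rewrite piM gE -[_ *m _]/(_ * _); case: x.
    rewrite piR; case: e {gE}.
      by have := normal 1%N (2 * 1 + m)%N; rewrite -[F ^+ 1 * _](rotF 1%N m).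
    by rewrite mul1r -exprS; have := normal 0%N m.+1; rewrite mul1r.
  by rewrite piF mulrA -exprS; apply: normal.
- rewrite piM gE -[_ *m _]/(_ * _); case: x.
    rewrite piRV; case: e {gE}.
      by have := normal 1%N (2 * 2 + m)%N; rewrite -[F ^+ 1 * _](rotF 2%N m).
    by rewrite mul1r -exprD; have := normal 0%N (2 + m)%N; rewrite mul1r.
  by rewrite piFV mulrA -exprS; apply: normal.
Qed.

(** This is how surjectivity of [rho] is used: a matrix that commutes with the images of [a] and [b]
    must commute with [F] and [R] as well. *)
Lemma pi_rho_centralizer (z : 'M[C]_3) :
  (forall x : bool, GRing.comm z (pi (rho (pres_gen x)))) ->
  forall d, GRing.comm z (pi d).
Proof.
case: pi_rep => pi1 piM _ _ zx d; have [g <-] := rho_surj d.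
have rho1 : rho 1%g = 1%g.
  by have := @gmulfM _ _ rho 1%g 1%g; rewrite mulg1 -{1}[rho _]mulg1 => /mulgI.
have phiM h h' : pi (rho (h * h')%g) = pi (rho h) * pi (rho h').
  by rewrite gmulfM piM.
have phiV h : pi (rho h^-1%g) = (pi (rho h))^-1.
  have hV : pi (rho h) * pi (rho h^-1%g) = 1 by rewrite -phiM mulgV rho1 pi1.
  have U : pi (rho h) \is a GRing.unit by case/mulmx1_unit: hV.
  by apply: (mulrI U); rewrite hV mulrV.
elim/pres_ind: g => [|x h IHh|x h IHh]; first by rewrite rho1 pi1; apply: commr1.
  by rewrite phiM; apply: commrM.
by rewrite phiM phiV; apply: commrM => //; apply: commrV.
Qed.

Lemma knot_rep_reflections :
  exists m m' : nat, [/\ (m < 3)%N, (m' < 3)%N, m != m',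
    pi (rho (pres_gen gen_a)) = refl_mx C m &
    pi (rho (pres_gen gen_b)) = refl_mx C m'].
Proof.
case: (pi_rep) => pi1 piM piF piR.
have [e [m [lt_m aE]]] := pi_dihedralE (rho (pres_gen gen_a)).
have [e' [m' [lt_m' bE]]] := pi_dihedralE (rho (pres_gen gen_b)).
have detE (f : bool) n : \det (F ^+ f * R ^+ n) = (-1) ^+ f.
  rewrite -[_ * _]/(_ *m _) det_mulmx.
  have -> : \det (R ^+ n) = 1.
    elim: n => [|n IHn]; first by rewrite expr0 det1.
    by rewrite exprS -[_ * _]/(_ *m _) det_mulmx det_rot IHn mulr1.
  by rewrite mulr1; case: f; rewrite ?det_flip // expr0 det1.
have FR_comm z : (forall x : bool, GRing.comm z (pi (rho (pres_gen x)))) ->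
    GRing.comm z F /\ GRing.comm z R.
  by move=> /pi_rho_centralizer zC; split; [rewrite -[F]piF | rewrite -[R]piR]; apply: zC.
(* The relation makes [a] and [b] conjugate by [w], so their determinants agree; as [2 != 0], the
   determinant tells reflections from rotations. *)
have ee' : e = e'.
  pose w := pres_of _ (knot_word p q) : knot_group p q.
  have knot_rel : (pres_gen gen_a * w = w * pres_gen gen_b :> knot_group p q)%g.
    rewrite -[LHS]pres_of_cat -[RHS]pres_of_cat.
    by apply/eqP/presentedP/word_eq_rel; rewrite mem_head.
  have := congr1 (fun g => \det (pi (rho g))) knot_rel.
  rewrite /= !gmulfM !piM !det_mulmx mulrC => eqdet.
  have [f [n [_ wE]]] := pi_dihedralE (rho w).
  move: eqdet; rewrite aE bE wE !detE => /(mulrI _).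
  have signU : (-1) ^+ f \is a @GRing.unit C by rewrite unitrX // unitrN1.
  move=> /(_ signU) /eqP; case: (e); case: (e') => //=.
    by rewrite expr0 expr1 eq_sym -addr_eq0 (negbTE two_neq0).
  by rewrite expr0 expr1 -addr_eq0 (negbTE two_neq0).
case: e aE ee' => aE ee'; rewrite -{}ee' in bE; last first.
  (* If both images were rotations, [R] would commute with them and therefore with [F]. *)
  case: flip_rot_noncomm; apply: commr_sym; apply: (FR_comm R _).1.
  by case; rewrite ?aE ?bE mul1r; apply: commrX.
exists m, m'; rewrite aE bE; split; rewrite ?flip_rot //.
(* If both were the same reflection [F * R ^+ m], it would commute with [R]; dividing by [R ^+ m],
   so would [F]. *)
apply/eqP => mm'; rewrite -{}mm' in bE.
have [|aF aR] := FR_comm (F ^+ 1 * R ^+ m).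
  by case; rewrite ?aE ?bE.
have RU : R ^+ m \is a GRing.unit.
  by rewrite unitrX // -(unitrX_pos _ (isT : (0 < 3)%N)) rot_cube unitr1.
case: flip_rot_noncomm; apply: commr_sym; rewrite -(mulrK RU F).
apply: commrM; first exact: commr_sym.
by apply/commrV/commrX.
Qed.
End DihedralRep.

(** * Identities of rational functions and the congruence modulo 3 *)

Section LaurentAlgebra.
Variables (K : fieldType) (t u D : K).
Hypotheses (tN0 : t != 0) (t6 : t ^+ 6 != 1).
Let alpha := (1 - u) / (1 - t ^+ 6).
Let Y := D / (t - 1) * t ^+ 4 * (t - 1) * (t + 1)
       * (t ^+ 6 * alpha - t ^+ 3 * alpha + 1)
       * (t ^+ 6 * alpha + t ^+ 3 * alpha + 1).

Let denom_neq0 : [/\ 1 - t ^+ 6 != 0, t - 1 != 0, 1 - t ^+ 2 != 0,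
  1 + t ^+ 3 != 0 & 1 - t ^+ 3 != 0].
Proof.
have t6' : 1 - t ^+ 6 != 0 by rewrite subr_eq0 eq_sym.
have dvd x y : 1 - t ^+ 6 = x * y -> x != 0.
  by move=> e; apply: contraNneq t6' => x0; rewrite e x0 mul0r.
split=> //.
- by apply: (dvd _ (- (1 + t + t ^+ 2 + t ^+ 3 + t ^+ 4 + t ^+ 5))); ring.
- by apply: (dvd _ (1 + t ^+ 2 + t ^+ 4)); ring.
- by apply: (dvd _ (1 - t ^+ 3)); ring.
- by apply: (dvd _ (1 + t ^+ 3)); ring.
Qed.

Lemma twisted_quotient :
  D * (- (t ^+ 2 - 1) ^+ 2 / t ^+ 2 * ((1 - u ^+ 2 * t ^+ 6) / (1 - t ^+ 6)))
    / ((t - 1) * (1 - t ^+ 2)) = t ^- 6 * Y.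
Proof.
have [t6' t1 t2 t3 t3'] := denom_neq0.
by rewrite /Y /alpha; field; rewrite ?t6' ?tN0 ?t1 ?t2.
Qed.

(** The denominator of [alpha] cancels because [(1 + t^3) (t^6 - t^3) = - t^3 (1 - t^6)]. *)
Lemma factor_closed_form g :
  (1 + t ^+ 3) * g = 1 + t ^+ 3 * u ->
  g = 1 - t ^+ 3 * alpha + t ^+ 6 * alpha.
Proof.
have [t6' _ _ t3 _] := denom_neq0.
by move=> gE; apply: (mulfI t3); rewrite gE /alpha; field.
Qed.

(** The factorization of [1 - u^2 t^6] into [1 + t^3 u] and [1 - t^3 u] is what splits the
    polynomial into [f(t)] and [f(-t)]; [g'] is [g] at [-t]. The factor [- t ^+ 9] is an admissible
    unit, 9 being a multiple of 3. *)
Lemma factor_product g g' :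
  (1 + t ^+ 3) * g = 1 + t ^+ 3 * u -> (1 - t ^+ 3) * g' = 1 - t ^+ 3 * u ->
  t ^+ 3 * D / (t - 1) * (t ^+ 2 * (1 + t) * g) * (t ^+ 2 * (1 - t) * g') =
  - t ^+ 9 * (t ^- 6 * Y).
Proof.
have [t6' t1 t2 t3 t3'] := denom_neq0.
move=> gE g'E; have -> : g = (1 + t ^+ 3 * u) / (1 + t ^+ 3).
  by rewrite -gE mulrC mulKf.
have -> : g' = (1 - t ^+ 3 * u) / (1 - t ^+ 3) by rewrite -g'E mulrC mulKf.
by rewrite /Y /alpha; field; rewrite ?t6' ?tN0 ?t1 ?t2 ?t3 ?t3'.
Qed.

End LaurentAlgebra.

(* The last summand is the witness of the congruence modulo 3: multiplying by
   [1 + x] makes the geometric sums [S] and [G] explicit. *)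
Lemma alexander_mod3_identity (A : idomainType) (x y S G J : A) :
  1 + x != 0 -> (x ^+ 2 - 1) * S = x ^+ 2 * y - 1 -> (1 + x ^+ 3) * G = 1 + x ^+ 3 * y ->
  alexander_form x y S J
  = (1 + x) ^+ 2 * G
    + (J *+ 2 * (x - 1) ^+ 2 * ((x - 1) * S - x * y) - (x - 1) ^+ 2 * S - x * G) *+ 3.
Proof.
move=> x1 SE GE; apply: (mulfI x1); apply/eqP; rewrite -subr_eq0; apply/eqP.
transitivity ((x ^+ 2 + x - 1) * ((x ^+ 2 - 1) * S - (x ^+ 2 * y - 1))
              - ((1 + x ^+ 3) * G - (1 + x ^+ 3 * y))); first by rewrite /alexander_form; ring.
by rewrite SE GE !subrr mulr0 subr0.
Qed.

(** * Assembly over the field of rational functions *)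

Lemma tvar_neq0 (C : fieldType) : tvar C != 0.
Proof. by rewrite tofrac_eq0 polyX_eq0. Qed.

Lemma tvar_expn_neq1 (C : fieldType) n : (0 < n)%N -> tvar C ^+ n != 1.
Proof.
move=> n_gt0; rewrite -tofracXn -tofrac1 tofrac_eq; apply/eqP.
move=> /(congr1 (size : {poly C} -> nat)).
by rewrite size_polyXn size_poly1; case: n n_gt0.
Qed.

Lemma map_refl_mx (C : fieldType) m :
  map_mx (@constf C) (refl_mx C m) = refl_mx (ratfun C) m.
Proof.
apply/matrixP => i j; rewrite !mxE /constf.
by case: (_ == _); rewrite ?polyC1 ?polyC0 ?tofrac1 ?tofrac0.
Qed.

Lemma twisted_alexanderE (C : fieldType) (k j p q : nat)
    (pi : dihedral_group 3 -> 'M[C]_3)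
    (rho : {multiplicative knot_group p q -> dihedral_group 3}) :
  p = (5 + 24 * j)%N -> q = (p * (6 * k).+1 + 4)%N ->
  (2%:R : C) != 0 -> (3%:R : C) != 0 ->
  is_dihedral_rep pi -> (forall d, exists g, rho g = d) ->
  let t := tvar C in
  let u := t ^+ (6 * k) in
  twisted_alexander (fun g => pi (rho g)) =
  alexander_poly C p q
  * (- (t ^+ 2 - 1) ^+ 2 / t ^+ 2 * ((1 - u ^+ 2 * t ^+ 6) / (1 - t ^+ 6)))
  / ((t - 1) * (1 - t ^+ 2)).
Proof.
move=> pE qE n2 n3 pi_rep rho_surj t u.
have odd_q : odd q by rewrite qE pE !oddD !oddM /= !oddM.
have [m [m' [lt_m lt_m' neq_m aE bE]]] := knot_rep_reflections _ _ _ _ _ pi_rep rho_surj n2.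
have n3' : (3%:R : ratfun C) != 0.
  by rewrite -(rmorph_nat (@FracField.tofrac _)) tofrac_eq0 -polyC_natr polyC_eq0.
pose M := tphi (fun g : knot_group p q => pi (rho g)).
have Ma : M gen_a = t *: refl_mx _ m by rewrite /M /tphi aE map_refl_mx.
have Mb : M gen_b = t *: refl_mx _ m' by rewrite /M /tphi bE map_refl_mx.
have [detA detB] := det_reflections _ _ _ _ _ (knot_word p q)
  lt_m lt_m' neq_m n3' (tvar_neq0 C) Ma Mb.
rewrite /twisted_alexander /A_hat -/M detA detB -(alexander_polyE _ _ _ odd_q).
by rewrite (fox_quot_rep _ _ k j) ?tvar_neq0 ?tvar_expn_neq1.
Qed.

HB.instance Definition _ (C : fieldType) :=
  GRing.RMorphism.copy (intpoly C) (@FracField.tofrac _ \o map_poly intr).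

Lemma intpolyX (C : fieldType) : intpoly C 'X = tvar C.
Proof. by rewrite /intpoly map_polyX. Qed.

Lemma laurent_cong_intpoly (C : fieldType) (P Q H : {poly int}) :
  Q = P + H *+ 3 -> laurent_cong 3 (intpoly C P) (intpoly C Q).
Proof.
move=> QE; exists 0%N, P, Q; rewrite expr0 !divr1; split=> // i.
by rewrite QE coefD coefMn addrC -mulr_natr natz modzMDl.
Qed.

(** The number of terms is odd, so this is [(1 + X^(6n+3)) / (1 + X^3)]; it provides the last factor
    of [f] as an integer polynomial. *)
Definition alternating_cubes (n : nat) : {poly int} := \sum_(i < n.*2.+1) (- 'X^3) ^+ i.
Definition geometric_squares (n : nat) : {poly int} := \sum_(i < n) 'X^2 ^+ i.

Lemma alternating_cubesE n : (1 + 'X^3) * alternating_cubes n = 1 + 'X^3 * 'X ^+ (6 * n).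
Proof.
have := subrX1 (- 'X^3 : {poly int}) n.*2.+1; rewrite -/(alternating_cubes n).
rewrite exprS exprNn -signr_odd odd_double expr0 mul1r -exprM => e.
have -> : (6 * n = 3 * n.*2)%N by lia.
by apply: oppr_inj; rewrite -mulNr opprD [- 1 - _]addrC -e mulNr opprD addrC.
Qed.

Lemma geometric_squaresE n :
  ('X^2 - 1) * geometric_squares (3 * n).+1 = 'X^2 * 'X^(6 * n) - 1.
Proof.
have -> : (6 * n = 2 * (3 * n))%N by lia.
by rewrite -subrX1 exprS -exprM.
Qed.

Lemma twisted_alexander_dihedral3 (C : fieldType) (k j p q : nat)
    (pi : dihedral_group 3 -> 'M[C]_3)
    (rho : {multiplicative knot_group p q -> dihedral_group 3}) :
  p = (5 + 24 * j)%N -> q = (p * (6 * k).+1 + 4)%N ->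
  (2%:R : C) != 0 -> (3%:R : C) != 0 ->
  is_dihedral_rep pi -> (forall d, exists g, rho g = d) ->
  let t := tvar C in
  let alpha := (1 - t ^+ (6 * k)) / (1 - t ^+ 6) in
  let Delta := alexander_poly C p q in
  let Dtw := twisted_alexander (fun g => pi (rho g)) in
  doteq 3 Dtw
    (Delta / (t - 1) * t ^+ 4 * (t - 1) * (t + 1)
       * (t ^+ 6 * alpha - t ^+ 3 * alpha + 1)
       * (t ^+ 6 * alpha + t ^+ 3 * alpha + 1))
  /\ exists f : {poly int},
       intpoly C f =
         t ^+ 2 * (1 + t) * (1 - t ^+ 3 * alpha + t ^+ 6 * alpha)
       /\ Hirasawa_Murasugi3 Dtw Delta f.
Proof.
move=> pE qE n2 n3 pi_rep rho_surj t alpha Delta Dtw.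
have tN0 : t != 0 := tvar_neq0 C.
have t6 : t ^+ 6 != 1 by rewrite tvar_expn_neq1.
set Y := _ * (t ^+ 6 * alpha + _ + 1).
have DtwE : Dtw = t ^- 6 * Y.
  have DtwE' := twisted_alexanderE _ k j _ _ _ _ pE qE n2 n3 pi_rep rho_surj.
  exact: etrans DtwE' (twisted_quotient _ t (t ^+ (6 * k)) Delta tN0 t6).
split; first by exists false, (-2); rewrite expr0 mul1r DtwE.
set u := t ^+ (6 * k) in alpha Y DtwE *.
set G := alternating_cubes k.
have GE : (1 + t ^+ 3) * intpoly C G = 1 + t ^+ 3 * u.
  have := congr1 (intpoly C) (alternating_cubesE k).
  by rewrite !(rmorphM, rmorphD, rmorph1, rmorphXn) /= intpolyX.
have cubeN (x : ratfun C) : - x * (- x * - x) = - x ^+ 3.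
  by rewrite mulrNN mulNr !exprS expr0 mulr1.
(* The exponent is even, so [u] is unchanged under [t -> -t], while [t ^+ 3] changes sign. *)
have exprN6 (x : ratfun C) : (- x) ^+ (6 * k) = x ^+ (6 * k).
  by rewrite exprNn -signr_odd oddM mul1r.
have GNE : (1 - t ^+ 3) * intpoly C (G \Po - 'X) = 1 - t ^+ 3 * u.
  have := congr1 (fun P => intpoly C (P \Po - 'X)) (alternating_cubesE k).
  rewrite !(rmorphM, rmorphD, rmorph1, rmorphXn) /= comp_polyX rmorphN /= intpolyX.
  by rewrite -/t -/G cubeN exprN6 mulNr.
pose f : {poly int} := 'X^2 * (1 + 'X) * G.
have fE : intpoly C f = t ^+ 2 * (1 + t) * intpoly C G.
  by rewrite !(rmorphM, rmorphD, rmorph1, rmorphXn) /= intpolyX.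
have fNE : intpoly C (f \Po - 'X) = t ^+ 2 * (1 - t) * intpoly C (G \Po - 'X).
  rewrite !(rmorphM, rmorphD, rmorph1, rmorphXn) /= comp_polyX rmorphN /= intpolyX.
  by rewrite mulrNN -expr2.
have GE' : intpoly C G = 1 - t ^+ 3 * alpha + t ^+ 6 * alpha.
  exact: factor_closed_form.
exists f; split.
  exact: etrans fE (congr1 (fun x => t ^+ 2 * (1 + t) * x) GE').
(* The representative [t ^+ 3 * Delta] fits because [t * Delta] is congruent to [(1 + t)^2 G] modulo
   3, while [(1 + t) f = t^2 (1 + t)^2 G]. *)
exists (t ^+ 3 * Delta / (t - 1) * intpoly C f * intpoly C (f \Po - 'X)), (t ^+ 3 * Delta).
have sgn9 : (-1) ^+ true * t ^ (3%:Z * 3) = - t ^+ 9 by rewrite expr1 mulN1r.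
have DtwP := factor_product _ t u Delta tN0 t6 _ _ GE GNE.
rewrite -fE -fNE in DtwP.
split; [|by exists false, 3; rewrite expr0 mul1r|by []|].
  by exists true, 3; rewrite sgn9 DtwE; exact: DtwP.
set S := geometric_squares (3 * k).+1.
have SE : (t ^+ 2 - 1) * intpoly C S = t ^+ 2 * u - 1.
  have := congr1 (intpoly C) (geometric_squaresE k).
  by rewrite !(rmorphM, rmorphD, rmorph1, rmorphXn, rmorphN) /= intpolyX.
have odd_q : odd q by rewrite qE pE !oddD !oddM /= !oddM.
have t2 : t ^+ 2 != 1 by rewrite tvar_expn_neq1.
have DeltaE := alexander_polyE C p q odd_q.
have tDelta := fox_scalar _ t k j p q pE qE tN0 t2 (intpoly C S) SE.
rewrite -DeltaE in tDelta.
pose Q : {poly int} := alexander_form 'X 'X^(6 * k) S j%:R.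
have QE : intpoly C Q = t * Delta.
  by rewrite tDelta rmorph_alexander_form /= rmorphXn rmorph_nat /= intpolyX.
have -> : (tvar C + 1) * intpoly C f = intpoly C (('X + 1) * f).
  by rewrite [RHS]rmorphM [in RHS]rmorphD rmorph1 /= intpolyX.
have -> : t ^+ 3 * Delta = intpoly C ('X^2 * Q).
  by rewrite [RHS]rmorphM /= QE rmorphXn /= intpolyX mulrA -exprSr.
have X1 : 1 + 'X != 0 :> {poly int} by rewrite -size_poly_eq0 addrC -polyC1 size_XaddC.
apply: laurent_cong_intpoly; rewrite /Q.
rewrite (alexander_mod3_identity _ _ _ _ _ _ X1 (geometric_squaresE k) (alternating_cubesE k)).
rewrite mulrDr mulrnAr; congr (_ + _); rewrite /f -/G.
ring.
Qed.

Theorem theorem17 (R : realType) (k j : nat) :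
  let p := (5 + 24 * j)%N in
  let q := (9 + 30 * k + 144 * j * k + 24 * j)%N in
  let t := tvar R[i] in
  let alpha := (1 - t ^+ (6 * k)) / (1 - t ^+ 6) in
  let Delta := alexander_poly R[i] p q in
  forall (pi : dihedral_group 3 -> 'M[R[i]]_3)
         (rho : {multiplicative knot_group p q -> dihedral_group 3}),
  is_dihedral_rep pi ->
  (forall d : dihedral_group 3, exists g : knot_group p q, rho g = d) ->
  let Dtw := twisted_alexander (fun g => pi (rho g)) in
  doteq 3 Dtw
    (Delta / (t - 1) * t ^+ 4 * (t - 1) * (t + 1)
       * (t ^+ 6 * alpha - t ^+ 3 * alpha + 1)
       * (t ^+ 6 * alpha + t ^+ 3 * alpha + 1))
  /\ exists f : {poly int},
       intpoly R[i] f =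
         t ^+ 2 * (1 + t) * (1 - t ^+ 3 * alpha + t ^+ 6 * alpha)
       /\ Hirasawa_Murasugi3 Dtw Delta f.
Proof.
move=> p q t alpha Delta pi rho pi_rep rho_surj Dtw.
have qE : q = (p * (6 * k).+1 + 4)%N by rewrite /p /q; lia.
by apply: (twisted_alexander_dihedral3 _ k j) => //; rewrite Num.Theory.pnatr_eq0.
Qed.
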